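(* Suppose that $(u_0,\dots,u_{m-1})\in\mathbf T(C)$ is a family of pairwise-orthogonal vectors. Set $A=\inf_{n<m}\{\|u_n\|\}$, $B=\sup_{n<m}\{\|u_n\|\}$, and $C'=\max\{CB,\frac CA\}$. Then $m\le 2^{(C')^2-2}$. In particular, for every string $s\in\mathbf T(C)$ consisting of pairwise-orthogonal vectors, $|s|\le 2^{C^4-2}$.
   Context: $\ell^2$ is the real Hilbert space of square-summable sequences. $2^{\mathbb N}$ is the Cantor space of infinite binary sequences and $C(2^{\mathbb N})$ is the Banach space of continuous real-valued functions on it with the supremum norm. Haar basis. Let $\mathcal O\subseteq 2^{<\mathbb N}$ consist of the empty string together with all finite binary strings ending in $0$. Enumerate $\mathcal O$ as $t_0,t_1,t_2,\ldots$ by increasing length and, among strings of equal length, lexicographically (at the first index where they differ, the string with entry $0$ comes first); thus $t_0=\varnothing$, $t_1=(0)$, $t_2=(00)$, $t_3=(10)$, $t_4=(000)$, $t_5=(010)$, $t_6=(100)$, $t_7=(110)$, etc. Let $V_n=\{\alpha\in 2^{\mathbb N}: t_n \text{ is an initial segment of }\alpha\}$ and $f_{t_n}=\chi_{V_n}\in C(2^{\mathbb N})$; $(f_{t_n})_{n\ge0}$ is the Haar basis of $C(2^{\mathbb N})$. For a real number $C\ge1$, $\mathbf T(C)=\mathbf T_{NU}(\ell^2,(f_{t_n}),C)$ is the tree of all finite sequences (strings) $(x_n)_{n=0}^{m-1}$ in $\ell^2$ such that for all real $a_0,\dots,a_{m-1}$, $$\tfrac1C\Big\|\sum_{n=0}^{m-1}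 a_nx_n\Big\|\le\Big\|\sum_{n=0}^{m-1} a_nf_{t_n}\Big\|_\infty\le C\Big\|\sum_{n=0}^{m-1} a_nx_n\Big\|.$$ $|s|$ denotes the length of a string $s$.
   Formalization: For m = 1 the claim fails as stated (C = 1 and u_0 a unit vector give 1 ≤ 1/2), so in the case m = 1 the formal theorem assumes (C')² ≥ 2, and in the second part C⁴ ≥ 2 when |s| = 1; all other m are unrestricted. *)

(* Defs.v *)
From HB Require Import structures.
From mathcomp Require Import all_boot all_order all_algebra.
From mathcomp Require Import all_classical all_reals all_analysis.
From mathcomp Require Import ring lra.

Set Implicit Arguments.
Unset Strict Implicit.
Unset Printing Implicit Defensive.

Import Order.TTheory GRing.Theory Num.Theory.
Import numFieldNormedType.Exports.

Local Open Scope classical_set_scope.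
Local Open Scope ring_scope.

(* Binary strings are lists of booleans, false standing for 0. *)

Fixpoint words (k : nat) : seq (seq bool) :=
  if k is k'.+1 then
    [seq false :: w | w <- words k'] ++ [seq true :: w | w <- words k']
  else [:: [::]].

(* The set O: the empty string and the strings ending in 0. *)
Definition inO (t : seq bool) : bool := ~~ last false t.

Definition haar_level (k : nat) : seq (seq bool) := [seq t <- words k | inO t].

(* haar_str n is t_n. Every level is nonempty, so the levels 0, ..., n hold
   at least n + 1 strings and the default value is never used; the lemmas
   haar_str_inO, haar_str_surj and haar_str_lt below characterize t. *)
Definition haar_str (n : nat) : seq bool :=
  nth [::] (flatten [seq haar_level k | k <- iota 0 n.+1]) n.

Definition str_lt (s t : seq bool) : bool :=
  (size s < size t)%N ||
  (size s == size t) && ((s : seqlexi bool) < (t : seqlexi bool))%O.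

Example haar_str_first :
  [seq haar_str n | n <- iota 0 8] =
  let o := false in let i := true in
  [:: [::]; [:: o]; [:: o; o]; [:: i; o];
      [:: o; o; o]; [:: o; i; o]; [:: i; o; o]; [:: i; i; o]].
Proof. by []. Qed.

Lemma mem_words k t : (t \in words k) = (size t == k).
Proof.
elim: k t => [|k IH] [|b t] //=.
  rewrite mem_cat; apply/negP => /orP[] /mapP[] //.
rewrite mem_cat eqSS -IH.
have inj (c : bool) : injective (cons c) by move=> x y [].
case: b; first have -> : (true :: t \in [seq false :: w | w <- words k]) = false.
- by apply/negP => /mapP[].
- by rewrite (mem_map (inj true)).
have -> : (false :: t \in [seq true :: w | w <- words k]) = false.
  by apply/negP => /mapP[].
by rewrite orbF (mem_map (inj false)).
Qed.

Lemma pairwise_words k :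
  pairwise (fun s t : seq bool => ((s : seqlexi bool) < (t : seqlexi bool))%O)
    (words k).
Proof.
elim: k => [//|k IH] /=; rewrite pairwise_cat !pairwise_map.
apply/and3P; split.
- by apply/allrelP => s t /mapP[s' _ ->] /mapP[t' _ ->]; rewrite ltxi_cons.
- by apply: sub_pairwise IH => s t /= st; rewrite ltxi_cons lexx st.
- by apply: sub_pairwise IH => s t /= st; rewrite ltxi_cons lexx st.
Qed.

Definition haar_list N := flatten [seq haar_level k | k <- iota 0 N].

Lemma haar_listS N : haar_list N.+1 = haar_list N ++ haar_level N.
Proof. by rewrite /haar_list -addn1 iotaD map_cat flatten_cat /= cats0. Qed.

Lemma mem_haar_list N t : (t \in haar_list N) = inO t && (size t < N)%N.
Proof.
elim: N => [|N IH]; first by rewrite andbF.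
by rewrite haar_listS mem_cat IH mem_filter mem_words -andb_orr orbC ltnS [(_ <= N)%N in RHS]leq_eqVlt.
Qed.

Lemma pairwise_haar_list N : pairwise str_lt (haar_list N).
Proof.
elim: N => [//|N IH]; rewrite haar_listS pairwise_cat IH /=; apply/andP; split.
  apply/allrelP => s t; rewrite mem_haar_list mem_filter mem_words.
  by move=> /andP[_ sN] /andP[_ /eqP tN]; rewrite /str_lt tN sN.
have : pairwise str_lt (words N).
  have := pairwise_words N; apply: (@sub_in_pairwise _ (mem (words N))).
    move=> s t; rewrite !mem_words => /eqP sN /eqP tN st.
    by rewrite /str_lt sN tN eqxx st orbT.
  exact/allP.
exact: subseq_pairwise (filter_subseq _ _).
Qed.

Lemma size_haar_list N : (N <= size (haar_list N))%N.
Proof.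
elim: N => [//|N IH]; rewrite haar_listS size_cat -addn1 leq_add//.
have : nseq N false \in haar_level N.
  rewrite mem_filter mem_words size_nseq eqxx andbT /inO.
  by elim: N {IH}.
by case: haar_level.
Qed.

Lemma haar_list_prefix N M : (N <= M)%N -> prefix (haar_list N) (haar_list M).
Proof.
move=> /subnK <-; elim: (M - N)%N => [|k IH]; first exact: prefix_refl.
rewrite addSn haar_listS; exact: prefix_trans IH (prefix_prefix _ _).
Qed.

Lemma haar_strE n N : (n < N)%N -> haar_str n = nth [::] (haar_list N) n.
Proof.
move=> nN; have /prefixP[s ->] := haar_list_prefix nN.
by rewrite nth_cat size_haar_list.
Qed.

Lemma haar_str_inO n : inO (haar_str n).
Proof.
have : haar_str n \in haar_list n.+1 by rewrite mem_nth// size_haar_list.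
by rewrite mem_haar_list => /andP[].
Qed.

Lemma haar_str_surj t : inO t -> exists n, haar_str n = t.
Proof.
move=> tO; have tN : t \in haar_list (size t).+1 by rewrite mem_haar_list tO /=.
exists (index t (haar_list (size t).+1)).
set i := index _ _; have [iN|Ni] := ltnP i (size t).+1.
  by rewrite (haar_strE iN) nth_index.
have /haar_list_prefix/prefixP[s sE] : ((size t).+1 <= i.+1)%N by rewrite ltnW.
rewrite (haar_strE (ltnSn i)) sE nth_cat.
by rewrite index_mem tN nth_index.
Qed.

Lemma haar_str_lt i j : (i < j)%N = str_lt (haar_str i) (haar_str j).
Proof.
have irr s : str_lt s s = false by rewrite /str_lt ltnn ltxx andbF.
have asym s t : str_lt s t -> str_lt t s = false.
  rewrite /str_lt; case: ltngtP => //= _; exact: lt_gtF.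
have lt a b : (a < b)%N -> str_lt (haar_str a) (haar_str b).
  move=> ab; rewrite (haar_strE (ltnSn b)) (haar_strE (ltn_trans ab (ltnSn b))).
  have sb := size_haar_list b.+1.
  have /pairwiseP := pairwise_haar_list b.+1; apply => //; rewrite inE//.
  exact: ltn_trans sb.
have [/lt->//|/lt/asym->//|->] := ltngtP i j.
by rewrite irr.
Qed.

Section Ell2.
Variable R : realType.

Lemma le1_2e : (1 <= 2%:E :> \bar R)%E.
Proof. by rewrite lee_fin ler1n. Qed.

(* The library's L^2 space for the counting measure on nat. Every function on
   nat is measurable and the empty set is the only null set, so its elements
   are exactly the square-summable real sequences (ell2_cvg, ell2_exists). *)
Definition ell2 : Type :=
  LfunType (counting : {measure set nat -> \bar R}) le1_2e.

HB.instance Definition _ := GRing.Lmodule.on ell2.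

Definition ell2_norm (x : ell2) : R :=
  fine (Lnorm (counting : {measure set nat -> \bar R}) 2%:E (EFin \o x)).

Definition ell2_dot (x y : ell2) : R := limn [series x k * y k]_k.

(* The norm of C(2^N). It is only applied to linear combinations of the
   haar_basis n, which are continuous (haar_basis_continuous), hence bounded. *)
Definition sup_norm (g : cantor_space -> R) : R :=
  sup [set `|g alpha| | alpha in [set: cantor_space]].

(* V_t: the points of the Cantor space extending the string t. *)
Definition cylinder (t : seq bool) : set cantor_space :=
  [set alpha : cantor_space | t = mkseq alpha (size t)].

Definition haar_basis (n : nat) : cantor_space -> R :=
  \1_(cylinder (haar_str n)).

(* The tree T_NU(l^2, (f_n), C). *)
Definition tree_NU (f : nat -> cantor_space -> R) (C : R) : set (seq ell2) :=
  [set s | forall a : nat -> R,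
    let x : ell2 := \sum_(n < size s) a n *: s`_n in
    let g := fun alpha => \sum_(n < size s) a n * f n alpha in
    C^-1 * ell2_norm x <= sup_norm g <= C * ell2_norm x].

Definition ell2_orthogonal (s : seq ell2) : Prop :=
  forall i j, (i < size s)%N -> (j < size s)%N -> i <> j ->
    ell2_dot s`_i s`_j = 0.

End Ell2.

Section Ell2Facts.
Variable R : realType.

Lemma eseries_cvg (v : nat -> R) : cvgn (series v) ->
  (\sum_(0 <= k <oo) (v k)%:E)%E = (limn (series v))%:E.
Proof.
move=> cv; rewrite -EFin_lim//; congr (lim (_ @ \oo)).
by apply/funext => n; rewrite /= sumEFin.
Qed.

Lemma eseries_lty_cvg (v : nat -> R) : (forall k, 0 <= v k) ->
  (\sum_(0 <= k <oo) (v k)%:E < +oo)%E -> cvgn (series v).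
Proof.
move=> v0 vy.
have -> : series v = fun n => \sum_(0 <= k < n | xpredT k) fine (v k)%:E by [].
apply: summable_cvg => [k _|]; first by rewrite lee_fin.
rewrite /summable -nneseries_esum; last by move=> k _; rewrite abse_ge0.
by rewrite (eq_eseriesr (g := fun k => (v k)%:E))// => k _; rewrite gee0_abs ?lee_fin.
Qed.

Lemma Lnorm2_nat (f : nat -> R) :
  Lnorm (counting : {measure set nat -> \bar R}) 2%:E (EFin \o f) =
  ((\sum_(0 <= k <oo) (f k ^+ 2)%:E) `^ 2^-1)%E.
Proof.
rewrite Lnorm_counting//; congr (_ `^ _)%E; apply: eq_eseriesr => k _.
by rewrite /= powR_mulrn// real_normK// num_real.
Qed.

Lemma ell2_cvg (x : ell2 R) : cvgn [series x k ^+ 2]_k.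
Proof.
apply: eseries_lty_cvg => [k|]; first exact: sqr_ge0.
have : finite_norm (counting : {measure set nat -> \bar R}) 2%:E x by [].
rewrite /finite_norm Lnorm2_nat => /lty_poweRy -> //.
Qed.

Lemma ell2_normE (x : ell2 R) :
  ell2_norm x = Num.sqrt (limn [series x k ^+ 2]_k).
Proof.
rewrite /ell2_norm Lnorm2_nat eseries_cvg; last exact: ell2_cvg.
rewrite poweR_EFin/= powR12_sqrt//.
apply: limr_ge; first exact: ell2_cvg.
by apply: nearW => n; apply: sumr_ge0 => k _; exact: sqr_ge0.
Qed.

Lemma ell2_exists (f : nat -> R) : cvgn [series f k ^+ 2]_k ->
  exists x : ell2 R, x = f :> (nat -> R).
Proof.
move=> cf; suff fL : f \in Lfun (counting : {measure set nat -> \bar R}) 2%:E.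
  by exists (Lfun_Sub (le1_2e R) fL).
apply/andP; split; rewrite inE//=.
by rewrite /finite_norm Lnorm2_nat eseries_cvg// poweR_EFin ltry.
Qed.

Lemma near_prefix (x : cantor_space) (k : nat) :
  nbhs x [set y : cantor_space | forall i, (i < k)%N -> y i = x i].
Proof.
elim: k => [|k IH]; first by apply: filterS filterT => y _ i; rewrite ltn0.
have kx : nbhs x [set y : cantor_space | y k = x k].
  exact: (@proj_continuous nat (fun=> bool) k x _ (discrete_set1 (x k))).
apply: filterS (filterI IH kx) => y [yI yk] i; rewrite ltnS leq_eqVlt.
by move=> /orP[/eqP ->|/yI].
Qed.

Lemma haar_basis_continuous n : continuous (@haar_basis R n).
Proof.
move=> x; apply: cvg_near_cst; set t := haar_str n.
apply: filterS (near_prefix x (size t)) => y yx.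
have xy : mkseq y (size t) = mkseq x (size t).
  by apply/eq_in_map => i; rewrite mem_iota => /yx.
rewrite /haar_basis !indicE; congr (nat_of_bool _)%:R.
by apply/idP/idP; rewrite !inE /cylinder /= -/t xy.
Qed.

(* A single unit vector belongs to T(1), with A = B = C = C' = 1 and m = 1,
   and 1 <= 2^(-1) is false. For m = 1 the bound m <= 2^(C'^2 - 2) amounts to
   2 <= C'^2, which therefore has to be assumed in that case; no assumption is
   added for m <> 1. *)
Lemma tree_NU_one_unit : exists u : ell2 R,
  [/\ ell2_norm u = 1, tree_NU (@haar_basis R) 1 [:: u] &
      ~ (1%:R <= (2 : R) `^ (1 ^+ 2 - 2))].
Proof.
pose f (k : nat) : R := (k == 0)%:R.
have sf c : [series (c * f k) ^+ 2]_k @ \oo --> c ^+ 2.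
  apply: cvg_near_cst; near=> n.
  have n0 : (0 < n)%N by near: n; exists 1%N.
  rewrite /series /= -(prednK n0) big_nat_recl//= /f eqxx mulr1 big1 ?addr0//.
  by move=> i _; rewrite /= mulr0 expr0n.
have [u uf] : exists u : ell2 R, u = f :> (nat -> R).
  apply: ell2_exists; apply/cvg_ex; exists (1 ^+ 2).
  rewrite (_ : [series f k ^+ 2]_k = [series (1 * f k) ^+ 2]_k)//.
  by congr series; apply/funext => k; rewrite /= mul1r.
have nu a : ell2_norm (a *: u) = `|a|.
  rewrite ell2_normE (_ : [series _]_k = [series (a * f k) ^+ 2]_k).
    by rewrite (cvg_lim _ (sf a))// sqrtr_sqr.
  by congr series; apply/funext => k; rewrite /= -uf.
exists u; split.
- by rewrite -[u]scale1r nu normr1.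
- move=> a /=; rewrite !big_ord_recl !big_ord0 addr0 nu invr1 !mul1r.
  rewrite /sup_norm; set X := [set _ | _ in _].
  suff -> : X = [set `|a 0%N|] by rewrite sup1 lexx.
  apply/seteqP; split => [r [al _ <-]|_ ->] /=.
    by rewrite big_ord_recl big_ord0 addr0 /haar_basis indicE mem_set ?mulr1.
  exists point => //.
  by rewrite big_ord_recl big_ord0 addr0 /haar_basis indicE mem_set ?mulr1.
- have -> : 1 ^+ 2 - 2 = - 1 :> R by ring.
  by rewrite powR_inv1//; lra.
Unshelve. all: by end_near. Qed.

End Ell2Facts.

(* Main.v *)
Require Import Defs.
From mathcomp Require Import all_boot all_order all_algebra.
From mathcomp Require Import all_classical all_reals all_analysis.
From mathcomp Require Import ring lra.

Import Order.TTheory GRing.Theory Num.Theory.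
Import numFieldNormedType.Exports.
Local Open Scope classical_set_scope.
Local Open Scope ring_scope.

(** The theorem holds because a bounded function can have many large Haar
coefficients. Put [a_0 = 1], and let the sum of the first [n] terms be [S_n].
The supports [V_n] of the Haar basis are such that [S_n] is constant on [V_n];
when this constant is [1] or [-1], the coefficient [a_n = - 2 S_n] merely flips
the sign of the sum on [V_n]. So there are coefficients with [a_0 = 1] and
[|a_n| = 2] for [n > 0] all of whose partial sums have absolute value [1]
everywhere ([unimodular_haar_sum]).

For orthogonal [u_0, ..., u_{m-1}] of norm at least [r > 0], Pythagoras
([ell2_pythagoras]) gives [r^2 (4 m - 3) <= |sum_n a_n u_n|^2], and membership
in the tree bounds the right side by [C^2]. Hence [4 m - 3 <= (C / r)^2]
([orthogonal_tree_size]), a bound on [m] linear in [(C / r)^2] that for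
[m >= 2] is stronger than the exponential one ([le_powR2_of_linear]). Taking
for [r] the least norm [A] gives the first claim, as [C / A <= C']. All norms
are at least [1 / C], since the functions of the Haar basis have norm [1]; so
[r = 1 / C] gives the second. *)

Section InnerProduct.
Variable R : realType.
Implicit Types x y z : ell2 R.

Lemma ell2_dot_cvg x y : cvgn [series x k * y k]_k.
Proof.
apply: normed_cvg.
apply: (@series_le_cvg _ _ (fun k => x k ^+ 2 + y k ^+ 2)) => [k|k|k|] /=.
- exact: normr_ge0.
- by rewrite addr_ge0 ?sqr_ge0.
- rewrite normrM -(real_normK (num_real (x k))) -(real_normK (num_real (y k))).
  by have := normr_ge0 (x k); have := normr_ge0 (y k); nra.
- apply: (is_cvg_seriesD (f := fun k => x k ^+ 2) (g := fun k => y k ^+ 2));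
  exact: ell2_cvg.
Qed.

Lemma ell2_dotC x y : ell2_dot x y = ell2_dot y x.
Proof. by congr (limn (series _)); apply/funext => k /=; rewrite mulrC. Qed.

Lemma ell2_dotDl x y z : ell2_dot (x + y) z = ell2_dot x z + ell2_dot y z.
Proof.
rewrite /ell2_dot -lim_seriesD; try exact: ell2_dot_cvg.
by congr (limn (series _)); apply/funext => k /=; rewrite -mulrDl.
Qed.

Lemma ell2_dotZl a x y : ell2_dot (a *: x) y = a * ell2_dot x y.
Proof.
rewrite /ell2_dot -[a * _]/(a *: _) -lim_seriesZ; last exact: ell2_dot_cvg.
by congr (limn (series _)); apply/funext => k /=; rewrite -mulrA.
Qed.

Lemma ell2_dot0l y : ell2_dot 0 y = 0.
Proof. by rewrite -[0](scale0r (0 : ell2 R)) ell2_dotZl mul0r. Qed.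

Lemma ell2_norm_ge0 x : 0 <= ell2_norm x.
Proof. by rewrite ell2_normE sqrtr_ge0. Qed.

Lemma ell2_dotxx x : ell2_dot x x = ell2_norm x ^+ 2.
Proof.
rewrite ell2_normE sqr_sqrtr//.
apply: limr_ge; first exact: ell2_cvg.
by apply: nearW => n; apply: sumr_ge0 => k _; exact: sqr_ge0.
Qed.

Lemma ell2_dot_suml n (v : 'I_n -> ell2 R) (a : 'I_n -> R) y :
  ell2_dot (\sum_i a i *: v i) y = \sum_i a i * ell2_dot (v i) y.
Proof.
rewrite (big_morph (fun x => ell2_dot x y)
  (fun x z => ell2_dotDl x z y) (ell2_dot0l y)).
by apply: eq_bigr => i _; rewrite ell2_dotZl.
Qed.

Lemma ell2_pythagoras (u : seq (ell2 R)) (a : nat -> R) :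
  ell2_orthogonal u ->
  ell2_norm (\sum_(n < size u) a n *: u`_n) ^+ 2 =
  \sum_(n < size u) a n ^+ 2 * ell2_norm u`_n ^+ 2.
Proof.
move=> uo; rewrite -ell2_dotxx ell2_dot_suml; apply: eq_bigr => i _.
rewrite ell2_dotC ell2_dot_suml (bigD1 i)//= big1 ?addr0.
  by rewrite ell2_dotxx mulrA -expr2.
move=> j ji; rewrite uo ?mulr0// => /val_inj jiE.
by rewrite jiE eqxx in ji.
Qed.

End InnerProduct.

Section HaarSums.
Variable R : realType.

Lemma cylinder_nonempty t : cylinder t !=set0.
Proof. by exists (nth false t); rewrite /cylinder /= mkseq_nth. Qed.

(** Along the enumeration the strings never get shorter, so membership in
[V_n] fixes all the bits on which an earlier basis function depends. *)
Lemma haar_basis_cst k n (al be : cantor_space) : (k < n)%N ->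
  cylinder (haar_str n) al -> cylinder (haar_str n) be ->
  haar_basis R k al = haar_basis R k be.
Proof.
rewrite haar_str_lt /cylinder /= => kn aln ben.
have sz : (size (haar_str k) <= size (haar_str n))%N.
  by case/orP: kn => [/ltnW//|/andP[/eqP ->]].
have prefixE (ga : cantor_space) : haar_str n = mkseq ga (size (haar_str n)) ->
    mkseq ga (size (haar_str k)) = take (size (haar_str k)) (haar_str n).
  by move=> ->; rewrite /mkseq -map_take take_iota (minn_idPl sz).
rewrite /haar_basis !indicE; congr (nat_of_bool _)%:R.
by apply/idP/idP; rewrite !inE /cylinder /= (prefixE al)// (prefixE be).
Qed.

(** The new coefficient is chosen to flip the sign of the previous sum on
[V_n], where that sum is constant. *)
Lemma unimodular_haar_sum m : exists a : nat -> R,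
  [/\ a 0 = 1, forall n, (0 < n <= m)%N -> a n ^+ 2 = 4 &
      forall al, `|\sum_(n < m.+1) a n * haar_basis R n al| = 1].
Proof.
elim: m => [|m [a [a0 a2 aS]]].
  exists (fun=> 1); split=> [//|[]//|al].
  by rewrite big_ord1 mul1r /haar_basis indicE mem_set ?normr1.
have [p pV] := cylinder_nonempty (haar_str m.+1).
pose S al := \sum_(n < m.+1) a n * haar_basis R n al.
pose b n := if n == m.+1 then - 2 * S p else a n.
exists b; split=> [//|n nm|al]; rewrite /b.
  case: eqVneq nm => [_ _|nm1 /andP[n0 nm]].
    by rewrite exprMn -[S p ^+ 2]real_normK ?num_real// /S aS; ring.
  by apply: a2; rewrite n0 -ltnS ltn_neqAle nm1.
rewrite big_ord_recr /= eqxx.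
have -> : \sum_(i < m.+1) (if i == m.+1 :> nat then - 2 * S p else a i)
    * haar_basis R i al = S al.
  by apply: eq_bigr => i _; rewrite ltn_eqF.
rewrite /haar_basis indicE; case: (boolP (al \in _)) => [|_].
  rewrite inE => alV; have -> : S p = S al.
    by apply: eq_bigr => i _; rewrite (@haar_basis_cst i m.+1 p al).
  by rewrite mulr1 (_ : _ + _ = - S al) ?normrN ?aS//; ring.
by rewrite mulr0 addr0 aS.
Qed.

Lemma sup_norm_le (g : cantor_space -> R) (M : R) :
  (forall al, `|g al| <= M) -> sup_norm g <= M.
Proof.
move=> gM; apply: ge_sup; first by exists `|g point|; exists point.
by move=> _ [al _ <-].
Qed.

Lemma sup_norm_haar_basis n : sup_norm (haar_basis R n) = 1.
Proof.
have le1 al : `|haar_basis R n al| <= 1.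
  by rewrite /haar_basis indicE ger0_norm ?lern1 ?leq_b1.
apply/eqP; rewrite eq_le sup_norm_le//=; apply: ub_le_sup.
  by exists 1 => _ [al _ <-].
have [p pV] := cylinder_nonempty (haar_str n).
by exists p => //; rewrite /haar_basis indicE mem_set ?normr1.
Qed.

End HaarSums.

Section Tree.
Variables (R : realType) (C : R).

(** The defining inequality of the tree, tested on the coefficients that are [1]
at [n] and [0] elsewhere, compares [u_n] with a function of norm [1]. *)
Lemma tree_NU_norm_ge (u : seq (ell2 R)) n :
  1 <= C -> tree_NU (haar_basis R) C u -> (n < size u)%N ->
  C^-1 <= ell2_norm u`_n.
Proof.
move=> C1 uT nu; have /andP[_] := uT (fun k => (k == n)%:R).
have delta (V : lmodType R) (v : nat -> V) :
    \sum_(k < size u) (k == n :> nat)%:R *: v k = v n.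
  rewrite (bigD1 (Ordinal nu))//= eqxx scale1r big1 ?addr0// => k kn.
  rewrite (_ : (k == n :> nat) = false) ?scale0r//.
  by apply: contraNF kn => /eqP kn; apply/eqP/val_inj.
rewrite (delta (ell2 R) (nth 0 u)).
have -> : (fun al => \sum_(k < size u) (k == n :> nat)%:R * haar_basis R k al)
    = haar_basis R n.
  by apply/funext => al; exact: (delta R^o (fun k => haar_basis R k al)).
by rewrite sup_norm_haar_basis -[C^-1]mulr1 ler_pdivrMl ?(lt_le_trans ltr01).
Qed.

(** A combination [x] of the [u_n] has [|x| <= C] as soon as the same combination
of the Haar basis is bounded by [1]; unimodular Haar sums make [|x|] as large as
[2 r] times the square root of [m], up to a bounded error. *)
Lemma orthogonal_tree_size (u : seq (ell2 R)) (r : R) :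
  1 <= C -> tree_NU (haar_basis R) C u -> ell2_orthogonal u -> 0 < r ->
  (forall n, (n < size u)%N -> r <= ell2_norm u`_n) ->
  4 * (size u)%:R - 3 <= (C / r) ^+ 2.
Proof.
move=> C1 uT uo r0 ru.
case umE : (size u) => [|m].
  by rewrite mulr0 sub0r (le_trans _ (sqr_ge0 _))// oppr_le0.
have [a [a0 a2 aS]] := unimodular_haar_sum R m.
have aP := ell2_pythagoras _ u a uo.
have := uT a => /=; rewrite !umE in ru aP * => /andP[xg _].
have x_le : ell2_norm (\sum_(n < m.+1) a n *: u`_n) <= C.
  have C0 : 0 < C by exact: lt_le_trans C1.
  rewrite ler_pdivrMl// in xg; apply: (le_trans xg).
  rewrite -[leRHS]mulr1 ler_pM2l//; apply: sup_norm_le => al.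
  by rewrite aS.
have sum_a : \sum_(n < m.+1) a n ^+ 2 = 4 * m.+1%:R - 3.
  rewrite big_ord_recl a0 expr1n (eq_bigr (fun=> 4)) => [|i _].
    by rewrite sumr_const card_ord -mulr_natr -natr1; ring.
  by rewrite a2//= /bump leq0n.
rewrite expr_div_n ler_pdivlMr ?exprn_gt0// -sum_a mulr_suml.
apply: le_trans (_ : ell2_norm (\sum_(n < m.+1) a n *: u`_n) ^+ 2 <= _).
  rewrite aP; apply: ler_sum => n _; rewrite ler_wpM2l ?sqr_ge0//.
  by rewrite ler_pXn2r ?nnegrE ?ell2_norm_ge0 ?(ltW r0)// ru.
by rewrite ler_pXn2r ?nnegrE ?ell2_norm_ge0// (le_trans ler01).
Qed.

End Tree.

(** The exponent is compared with [4 m - 5], and [m <= 2^(4 m - 5)] for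
[m >= 2]; for [m = 1] this last inequality fails, whence the hypothesis. *)
Lemma le_powR2_of_linear (R : realType) (m : nat) (D : R) :
  4 * m%:R - 3 <= D -> (m = 1%N -> 2 <= D) -> m%:R <= 2 `^ (D - 2).
Proof.
case: m => [_ _|[_ /(_ erefl) D2|m mD _]]; first exact: powR_ge0.
  by rewrite -[1%:R](powRr0 2) ler_powR ?ler1n// subr_ge0.
have le_m : m.+2%:R <= 2 `^ (m.+1%:R) :> R.
  by rewrite powR_mulrn// -natrX ler_nat ltn_expl.
apply: le_trans le_m _; rewrite ler_powR ?ler1n//.
move: mD; rewrite -(addn1 m.+1) -(addn1 m) !natrD.
by have := ler0n R m; lra.
Qed.

Theorem lemma13 (R : realType) (C : R) (hC : 1 <= C) :
  (forall u : seq (ell2 R),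
     tree_NU (haar_basis R) C u ->
     ell2_orthogonal u ->
     let m := size u in
     let A := inf [set ell2_norm u`_n | n in [set n | (n < m)%N]] in
     let B := sup [set ell2_norm u`_n | n in [set n | (n < m)%N]] in
     let C' := Num.max (C * B) (C / A) in
     (m = 1%N -> 2 <= C' ^+ 2) ->
     m%:R <= 2 `^ (C' ^+ 2 - 2)) /\
  (forall s : seq (ell2 R),
     tree_NU (haar_basis R) C s ->
     ell2_orthogonal s ->
     (size s = 1%N -> 2 <= C ^+ 4) ->
     (size s)%:R <= 2 `^ (C ^+ 4 - 2)).
Proof.
have C0 : 0 < C by exact: lt_le_trans hC.
split=> [u uT uo m A B C' m1|s sT so s1].
  apply: le_powR2_of_linear => //; have [m0|m_gt0] := posnP m.
    by rewrite m0 mulr0 sub0r (le_trans _ (sqr_ge0 _))// oppr_le0.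
  pose N := [set ell2_norm u`_n | n in [set n | (n < m)%N]].
  have lbN : lbound N C^-1 by move=> _ [n nm <-]; exact: tree_NU_norm_ge.
  have A0 : 0 < A.
    apply: lt_le_trans (_ : C^-1 <= A); first by rewrite invr_gt0.
    by apply: lb_le_inf => //; exists (ell2_norm u`_0), 0%N.
  apply: (@le_trans _ _ ((C / A) ^+ 2)).
    apply: orthogonal_tree_size => // n nm.
    by apply: ge_inf; [exists C^-1|exists n].
  have CA : 0 <= C / A by rewrite divr_ge0 ?ltW.
  by rewrite ler_pXn2r ?nnegrE ?le_max ?CA ?lexx ?orbT.
apply: le_powR2_of_linear => //.
rewrite (_ : C ^+ 4 = (C / C^-1) ^+ 2); last by rewrite invrK -expr2 -exprM.
apply: orthogonal_tree_size => // [|n]; first by rewrite invr_gt0.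
exact: tree_NU_norm_ge.
Qed.
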